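(* Let $R\subset S$ be an unramified Gilmer extension whose nucleus $R/(R:S)$ is reduced. Then $R\subset S$ is finite and has FIP.
   Context: Rings are commutative with identity. $(R:S)=\{r\in R\mid rS\subseteq R\}$, the nucleus is $R/(R:S)$, and $R\subset S$ is a Gilmer extension if the nucleus is Artinian. Unramified: $S$ of finite type over $R$ with $\Omega(S|R)=0$. FIP: finitely many $R$-subalgebras of $S$. *)

(* Defs.v *)
(* A ring extension R ⊂ S is modelled by a commutative ring
   S : comRingType together with a subring R of S given as a predicate. *)
From HB Require Import structures.
From mathcomp Require Import all_boot all_order all_algebra.
From Stdlib Require List.
Set Implicit Arguments. Unset Strict Implicit. Unset Printing Implicit Defensive.
Import GRing.Theory.
Local Open Scope ring_scope.

Section Defs.
Variable S : comPzRingType.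

Definition is_subring (T : S -> Prop) : Prop :=
  [/\ T 1, (forall x y, T x -> T y -> T (x - y)) &
      (forall x y, T x -> T y -> T (x * y))].

Definition is_subalgebra (R T : S -> Prop) : Prop :=
  is_subring T /\ (forall r, R r -> T r).

Definition conductor (R : S -> Prop) (x : S) : Prop :=
  R x /\ (forall s, R (x * s)).

(* Ideals of R containing a subset c (= ideals of the quotient R/c). *)
Definition ideal_over (R c I : S -> Prop) : Prop :=
  [/\ (forall x, I x -> R x), (forall x, c x -> I x), I 0,
      (forall x y, I x -> I y -> I (x + y)) &
      (forall r x, R r -> I x -> I (r * x))].

Definition nucleus_artinian (R : S -> Prop) : Prop :=
  forall I : nat -> S -> Prop,
    (forall n, ideal_over R (conductor R) (I n)) ->
    (forall n x, I n.+1 x -> I n x) ->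
    exists N, forall n, (N <= n)%N -> forall x, I n x <-> I N x.

Definition gilmer (R : S -> Prop) : Prop := nucleus_artinian R.

Definition nucleus_reduced (R : S -> Prop) : Prop :=
  forall x n, R x -> conductor R (x ^+ n) -> conductor R x.

(* S is of finite type over R: S = R[gens] for a finite list gens, i.e. every
   element lies in every R-subalgebra containing gens. *)
Definition finite_type (R : S -> Prop) : Prop :=
  exists gens : seq S, forall x, forall T, is_subalgebra R T ->
    (forall g, g \in gens -> T g) -> T x.

(* Kähler differentials Omega(S|R): the free S-module on symbols d s (s : S)
   modulo the S-submodule generated by d(a+b)-da-db, d(ab)-a db-b da, and
   d r (r in R).  A formal element sum_i c_i d(s_i) is a list of pairs
   (c_i, s_i); its coefficient function is [fsum]. *)
Definition fsum (l : seq (S * S)) (x : S) : S :=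
  \sum_(p <- l | p.2 == x) p.1.

Definition fscale (c : S) (l : seq (S * S)) : seq (S * S) :=
  [seq (c * p.1, p.2) | p <- l].

Inductive kahler_rel (R : S -> Prop) : seq (S * S) -> Prop :=
| kr_nil : kahler_rel R [::]
| kr_add c a b l : kahler_rel R l ->
    kahler_rel R (fscale c [:: (1, a + b); (-1, a); (-1, b)] ++ l)
| kr_mul c a b l : kahler_rel R l ->
    kahler_rel R (fscale c [:: (1, a * b); (- a, b); (- b, a)] ++ l)
| kr_base c r l : R r -> kahler_rel R l ->
    kahler_rel R (fscale c [:: (1, r)] ++ l).

(* Omega(S|R) = 0: every generator d s lies in the relation submodule. *)
Definition kahler_zero (R : S -> Prop) : Prop :=
  forall s : S, exists l, kahler_rel R l /\ forall x, fsum l x = fsum [:: (1, s)] x.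

Definition unramified (R : S -> Prop) : Prop :=
  finite_type R /\ kahler_zero R.

Definition finite_ext (R : S -> Prop) : Prop :=
  exists gens : seq S, forall x, exists coef : seq S,
    [/\ size coef = size gens, (forall i, R coef`_i) &
        x = \sum_(i < size gens) coef`_i * gens`_i].

Definition FIP (R : S -> Prop) : Prop :=
  exists L : seq (S -> Prop), forall T, is_subalgebra R T ->
    exists2 T', List.In T' L & forall x, T x <-> T' x.

End Defs.

(* Main.v *)
(** Let [C] be the conductor, [A = S/C] and [k = R/C].  Being reduced and
    Artinian, [k] has all its ideals generated by idempotents, so every
    [k]-submodule of a [k]-algebra is a direct summand.  Vanishing of the
    differentials gives a separability idempotent [e = \sum p_i (x) q_i] of [A]
    over [k].  With a [k]-linear retraction [F] onto the span of the [p_i],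
    [a = \sum F (a p_i) q_i] shows that [A] is finite over [k]; averaging
    retractions with [e] shows that all ideals of [A], and likewise of
    [A (x) A], are generated by idempotents, of which there are finitely many.
    A [k]-subalgebra [T] is again reduced and Artinian, hence [A] retracts
    [T]-linearly onto [T], and [T] is recovered from the ideal of [A (x) A]
    generated by the elements [t (x) 1 - 1 (x) t]. *)
Require Import Defs.
From HB Require Import structures.
From mathcomp Require Import all_boot all_order all_algebra.
From mathcomp Require Import generic_quotient boolp classical_sets ring.
Set Implicit Arguments. Unset Strict Implicit. Unset Printing Implicit Defensive.
Import GRing.Theory.
Local Open Scope ring_scope.
Local Open Scope quotient_scope.

(** * Quotients of commutative rings *)

(** The ring laws are required only up to [e], so that [X] may be a type of formal sums as well as a
    ring. This serves both for [S/C] and for the tensor square. *)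
Lemma setoid_ring_quotient (X : choiceType) (e : X -> X -> Prop)
    (zero one : X) (opp : X -> X) (add mul : X -> X -> X) :
  (forall x, e x x) -> (forall x y, e x y -> e y x) ->
  (forall y x z, e x y -> e y z -> e x z) ->
  (forall x x', e x x' -> e (opp x) (opp x')) ->
  (forall x x' y y', e x x' -> e y y' -> e (add x y) (add x' y')) ->
  (forall x x' y y', e x x' -> e y y' -> e (mul x y) (mul x' y')) ->
  (forall x y z, e (add x (add y z)) (add (add x y) z)) ->
  (forall x y, e (add x y) (add y x)) -> (forall x, e (add zero x) x) ->
  (forall x, e (add (opp x) x) zero) ->
  (forall x y z, e (mul x (mul y z)) (mul (mul x y) z)) ->
  (forall x y, e (mul x y) (mul y x)) -> (forall x, e (mul one x) x) ->
  (forall x y z, e (mul (add x y) z) (add (mul x z) (mul y z))) ->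
  exists (Q : comPzRingType) (p : X -> Q), [/\ forall q, exists x, q = p x,
    forall x y, p x = p y <-> e x y,
    forall x y, p (add x y) = p x + p y,
    forall x y, p (mul x y) = p x * p y & p one = 1].
Proof.
move=> er es et eN eD eM addA addC add0 addN mulA mulC mul1 mulDl.
pose r : rel X := fun x y => `[< e x y >].
have r_refl : reflexive r by move=> x; apply/asboolP.
have r_sym : symmetric r.
  by move=> x y; apply/idP/idP => /asboolP h; apply/asboolP; exact: es.
have r_trans : transitive r.
  by move=> y x z /asboolP h /asboolP h'; apply/asboolP; exact: et h h'.
pose E := EquivRel r r_refl r_sym r_trans.
pose Q0 : choiceType := {eq_quot E}.
pose p (x : X) : Q0 := \pi_({eq_quot E}) x.
have pE x y : p x = p y <-> e x y.
  rewrite /p; split=> [/eqP|h].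
    by rewrite eqmodE => /asboolP.
  by apply/eqP; rewrite eqmodE; apply/asboolP.
pose s (q : Q0) : X := repr q.
have sK q : p (s q) = q by rewrite /p /s reprK.
have ps x : e (s (p x)) x by apply/pE; rewrite sK.
pose qadd a b := p (add (s a) (s b)).
pose qmul a b := p (mul (s a) (s b)).
pose qopp a := p (opp (s a)).
have qaddE x y : qadd (p x) (p y) = p (add x y) by apply/pE; exact: eD.
have qmulE x y : qmul (p x) (p y) = p (mul x y) by apply/pE; exact: eM.
have qoppE x : qopp (p x) = p (opp x) by apply/pE; exact: eN.
have surj q : exists x, q = p x by exists (s q).
have qaddA : associative qadd.
  move=> a b c; case: (surj a) (surj b) (surj c) => x -> [y ->] [z ->].
  by rewrite !qaddE; apply/pE.
have qaddC : commutative qadd.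
  by move=> a b; case: (surj a) (surj b) => x -> [y ->]; rewrite !qaddE; apply/pE.
have qadd0 : left_id (p zero) qadd.
  by move=> a; case: (surj a) => x ->; rewrite !qaddE; apply/pE.
have qaddN : left_inverse (p zero) qopp qadd.
  by move=> a; case: (surj a) => x ->; rewrite qoppE !qaddE; apply/pE.
have qmulA : associative qmul.
  move=> a b c; case: (surj a) (surj b) (surj c) => x -> [y ->] [z ->].
  by rewrite !qmulE; apply/pE.
have qmulC : commutative qmul.
  by move=> a b; case: (surj a) (surj b) => x -> [y ->]; rewrite !qmulE; apply/pE.
have qmul1 : left_id (p one) qmul.
  by move=> a; case: (surj a) => x ->; rewrite !qmulE; apply/pE.
have qmulDl : left_distributive qmul qadd.
  move=> a b c; case: (surj a) (surj b) (surj c) => x -> [y ->] [z ->].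
  by rewrite !(qmulE, qaddE); apply/pE.
pose Qz : zmodType :=
  HB.pack Q0 (GRing.isZmodule.Build Q0 qaddA qaddC qadd0 qaddN).
pose Q : comPzRingType :=
  HB.pack Q0 Qz (GRing.Zmodule_isComPzRing.Build Qz qmulA qmulC qmul1 qmulDl).
by exists Q, p; split=> // x y; rewrite -?qaddE -?qmulE.
Qed.

Lemma ideal_quotient (S : comPzRingType) (C : S -> Prop) :
  C 0 -> (forall x y, C x -> C y -> C (x + y)) ->
  (forall s x, C x -> C (s * x)) ->
  exists (A : comPzRingType) (p : {rmorphism S -> A}),
    (forall a, exists x, a = p x) /\ (forall x, p x = 0 <-> C x).
Proof.
move=> C0 CD CM.
have CN x : C x -> C (- x) by rewrite -mulN1r; exact: CM.
pose e x y := C (x - y).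
have eP x y z : C z -> z = x - y -> e x y by rewrite /e => h <-.
have [Q [p [surj pE pD pM p1]]] : exists (Q : comPzRingType) (p : S -> Q),
  [/\ forall q, exists x, q = p x, forall x y, p x = p y <-> e x y,
    forall x y, p (x + y) = p x + p y, forall x y, p (x * y) = p x * p y & p 1 = 1].
  apply: (setoid_ring_quotient (zero := 0) (opp := -%R)).
  - by move=> x; apply: (eP _ _ _ C0); ring.
  - by move=> x y /CN h; apply: (eP _ _ _ h); ring.
  - by move=> y x z h h'; apply: (eP _ _ _ (CD _ _ h h')); ring.
  - by move=> x x' /CN h; apply: (eP _ _ _ h); ring.
  - by move=> x x' y y' h h'; apply: (eP _ _ _ (CD _ _ h h')); ring.
  - by move=> x x' y y' h h'; apply: (eP _ _ _ (CD _ _ (CM y _ h) (CM x' _ h'))); ring.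
  1-8: by move=> *; apply: (eP _ _ _ C0); ring.
have p0 : p 0 = 0 by apply: (@addrI _ (p 0)); rewrite -pD !addr0.
have pB : zmod_morphism p.
  by move=> x y; apply: (@addIr _ (p y)); rewrite -pD !subrK.
pose pm : {rmorphism S -> Q} :=
  HB.pack p (GRing.isZmodMorphism.Build S Q p pB)
            (GRing.isMonoidMorphism.Build S Q p (p1, pM)).
exists Q, pm; split=> // x; change (p x = 0 <-> C x).
by rewrite -p0 pE /e subr0.
Qed.

(** * Submodules over a subring, descending chains, idempotents and retractions *)

Section Submodules.
Variable A : comPzRingType.
Implicit Types (T V I : A -> Prop).

Definition submodule T V : Prop :=
  [/\ V 0, forall x y, V x -> V y -> V (x + y) & forall t x, T t -> V x -> V (t * x)].

(** For a subring [T] the sets [I] are its ideals. The element [f] lies in [I] and acts on it as the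
    identity, so it is idempotent and [I] is the principal ideal [T f]. *)
Definition idempotent_generated T : Prop :=
  forall I, submodule T I -> (forall x, I x -> T x) ->
  exists2 f, I f & forall x, I x -> x * f = x.

Definition dcc T V : Prop :=
  forall I : nat -> A -> Prop,
    (forall n, submodule T (I n)) -> (forall n x, I n x -> V x) ->
    (forall n x, I n.+1 x -> I n x) ->
    exists N, forall n, (N <= n)%N -> forall x, I N x -> I n x.

Lemma subring0 T : is_subring T -> T 0.
Proof. by case=> T1 TB _; rewrite -(subrr 1); exact: TB. Qed.

Lemma subringN T x : is_subring T -> T x -> T (- x).
Proof.
by move=> hT Tx; rewrite -sub0r; case: (hT) => _ TB _; apply: TB => //; exact: subring0.
Qed.

Lemma subringD T x y : is_subring T -> T x -> T y -> T (x + y).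
Proof.
by move=> hT Tx Ty; rewrite -(opprK y); case: (hT) => _ TB _; apply: TB => //; exact: subringN.
Qed.

Lemma subringX T x n : is_subring T -> T x -> T (x ^+ n).
Proof.
case=> T1 _ TM Tx; elim: n => [|n IH]; first by rewrite expr0.
by rewrite exprS; exact: TM.
Qed.

Lemma submoduleN T V x : is_subring T -> submodule T V -> V x -> V (- x).
Proof.
move=> hT [_ _ VM] Vx; rewrite -mulN1r; apply: VM => //.
by apply: subringN => //; case: hT.
Qed.

Lemma submoduleB T V x y :
  is_subring T -> submodule T V -> V x -> V y -> V (x - y).
Proof.
by move=> hT hV Vx Vy; case: (hV) => _ VD _; apply: VD => //; exact: submoduleN hV Vy.
Qed.

Lemma submodule_sum T V (J : Type) (r : seq J) (P : pred J) (F : J -> A) :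
  submodule T V -> (forall i, P i -> V (F i)) -> V (\sum_(i <- r | P i) F i).
Proof. by case=> V0 VD _ h; apply: big_ind. Qed.

Lemma submodule_sum_in T V (J : eqType) (r : seq J) (F : J -> A) :
  submodule T V -> (forall i, i \in r -> V (F i)) -> V (\sum_(i <- r) F i).
Proof. by case=> V0 VD _ h; rewrite big_seq; apply: big_ind. Qed.

Lemma submodule_principal T a : is_subring T -> submodule T (fun x => exists2 t, T t & x = t * a).
Proof.
move=> hT; case: (hT) => T1 TB TM; split.
- by exists 0; [exact: subring0 | rewrite mul0r].
- move=> _ _ [t Tt ->] [t' Tt' ->]; exists (t + t'); first exact: subringD.
  by rewrite mulrDl.
- by move=> t _ Tt [t' Tt' ->]; exists (t * t'); [exact: TM | rewrite mulrA].
Qed.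

(** Otherwise every index satisfying [P] has a successor with a strictly smaller [W], and iterating
    a choice of successors contradicts [dcc]. The index type lets one minimise over elements through
    a submodule attached to them, such as an annihilator. *)
Lemma dcc_minimal (T V : A -> Prop) (J : Type) (P : J -> Prop) (W : J -> A -> Prop) :
  dcc T V -> (forall j, submodule T (W j)) -> (forall j x, W j x -> V x) ->
  (exists j, P j) ->
  exists2 j, P j & forall j', P j' ->
    (forall x, W j' x -> W j x) -> forall x, W j x -> W j' x.
Proof.
move=> dccT subW WV [j0 Pj0]; apply: contrapT => nomin.
have step (j : {j | P j}) : exists j' : {j | P j},
    (forall x, W (sval j') x -> W (sval j) x) /\
    exists x, W (sval j) x /\ ~ W (sval j') x.
  apply: contrapT => h; apply: nomin; exists (sval j); first exact: svalP.
  move=> j' Pj' sub x Wx; apply: contrapT => nWx; apply: h.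
  by exists (exist _ j' Pj'); split=> //; exists x.
have [g gP] := choice step.
pose s n := iter n g (exist P j0 Pj0).
have [N NP] := dccT (fun n => W (sval (s n))) (fun n => subW _)
  (fun n => @WV _) (fun n => (gP (s n)).1).
have [x [Wx nWx]] := (gP (s N)).2.
exact/nWx/(NP N.+1).
Qed.

(* Reducedness and stabilisation of the powers of [t] give [t = t ^+ 2 * s]. *)
Lemma dcc_reduced_regular T :
  is_subring T -> dcc T T -> (forall t, T t -> forall n, t ^+ n = 0 -> t = 0) ->
  forall t, T t -> exists2 s, T s & t = t ^+ 2 * s.
Proof.
move=> hT dccT redT t Tt; case: (hT) => T1 TB TM.
have [N NP] := dccT (fun n x => exists2 s, T s & x = s * t ^+ n)
  (fun n => submodule_principal _ hT) (fun n x => ltac:(move=> [s Ts ->]; apply: TM => //; exact: subringX))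
  (fun n x => ltac:(move=> [s Ts ->]; exists (s * t); [exact: TM | by rewrite exprS mulrA])).
have [|s Ts ts] := NP N.+1 (leqnSn N) (t ^+ N).
  by exists 1; rewrite ?mul1r.
exists s => //; apply/eqP; rewrite -subr_eq0; apply/eqP.
(* Stability gives [t ^+ N = s * t ^+ N.+1], so [t ^+ N * (1 - s * t)] vanishes. The power [N.+1] of
   [t * (1 - s * t)] contains this factor. *)
apply: (redT _ _ N.+1); first by apply: TB => //; apply: TM => //; exact: subringX.
have -> : t - t ^+ 2 * s = t * (1 - s * t) by ring.
have h : t ^+ N * (1 - s * t) = 0.
  by rewrite mulrBr mulr1 {1}ts exprS; ring.
rewrite exprMn exprS [(1 - s * t) ^+ _]exprS -mulrA [t ^+ N * _]mulrA h.
by rewrite mul0r mulr0.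
Qed.

(** Take an idempotent [f] of [I] whose annihilator in [T] is minimal. For [x] in [I], regularity of
    [y = x * (1 - f)] yields an idempotent [s * y] orthogonal to [f]; unless [y = 0], the idempotent
    [f + s * y] of [I] has a strictly smaller annihilator. *)
Lemma dcc_reduced_idempotent_generated T :
  is_subring T -> dcc T T -> (forall t, T t -> forall n, t ^+ n = 0 -> t = 0) ->
  idempotent_generated T.
Proof.
move=> hT dccT redT I hI IT; case: (hT) => T1 TB TM; case: (hI) => I0 ID IM.
have [|||f [If ff] fmin] := @dcc_minimal T T A (fun f => I f /\ f * f = f)
    (fun f x => T x /\ x * f = 0) dccT.
- move=> f; split; first by rewrite mul0r; split=> //; exact: subring0.
  + by move=> x y [Tx xf] [Ty yf]; split; [exact: subringD | rewrite mulrDl xf yf addr0].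
  + by move=> t x Tt [Tx xf]; split; [exact: TM | rewrite -mulrA xf mulr0].
- by move=> f x [].
- by exists 0; rewrite mul0r.
exists f => // x Ix.
have Tx := IT _ Ix; have Tf := IT _ If.
have Iy : I (x * (1 - f)).
  by rewrite mulrC; apply: IM => //; exact: TB.
have [s Ts ys] := dcc_reduced_regular hT dccT redT (IT _ Iy).
set y := x * (1 - f) in Iy ys.
have yf : y * f = 0 by rewrite /y -mulrA mulrBl mul1r ff subrr mulr0.
have ygy : y * (s * y) = y by rewrite [RHS]ys; ring.
have f1 : (1 - f) * f = 0 by rewrite mulrBl mul1r ff subrr.
have gP : I (f + s * y) /\ (f + s * y) * (f + s * y) = f + s * y.
  split; first by apply: ID => //; exact: IM.
  have -> : (f + s * y) * (f + s * y) =
      f * f + s * (y * (s * y)) + s * (y * f) + s * (y * f) by ring.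
  by rewrite ff ygy yf mulr0 !addr0.
have gf z : T z /\ z * (f + s * y) = 0 -> T z /\ z * f = 0.
  case=> Tz /(congr1 (fun u => u * f)) /=; rewrite mul0r -mulrA mulrDl ff -mulrA yf.
  by rewrite mulr0 addr0.
(* Since [1 - f] kills [f], minimality makes it kill [f + s * y] too; multiplying by [y] gives
   [y = 0]. *)
have [_ h] := fmin _ gP gf (1 - f) (conj (TB _ _ T1 Tf) f1).
have : y = 0.
  rewrite -ygy -[RHS](mulr0 y) -h.
  have -> : y * ((1 - f) * (f + s * y)) = y * (f - f * f + s * y) - s * y * (y * f) by ring.
  by rewrite ff subrr add0r yf mulr0 subr0.
by rewrite /y mulrBr mulr1 => /eqP; rewrite subr_eq0 => /eqP.
Qed.

(* A [T]-submodule maximal among those meeting [V] trivially is a complement of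
   [V]: an idempotent generating the conductor of a missing element [a] into
   the sum lets one enlarge the submodule. *)
Lemma idempotent_generated_complement T V :
  is_subring T -> idempotent_generated T -> submodule T V ->
  exists W, [/\ submodule T W, forall x, W x -> V x -> x = 0 &
                forall x, exists2 v, V v & W (x - v)].
Proof.
move=> hT igT hV; case: (hT) => T1 TB TM; case: (hV) => V0 VD VM.
(* Membership of [0] is left out of [P] because the union of the empty chain is empty; it is
   recovered from maximality in [N0]. *)
pose P (N : set A) := [/\ forall x y, N x -> N y -> N (x + y),
  forall t x, T t -> N x -> N (t * x) & forall x, N x -> V x -> x = 0].
have [N [[ND NM NV] Nmax]] : exists N, P N /\ forall B, (N `<` B)%classic -> ~ P B.
  apply: Zorn_bigcup => F FP Ftot; split.
  - move=> x y [X FX Xx] [Y FY Yy].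
    have [XY|YX] := Ftot X Y FX FY.
      by exists Y => //; case: (FP _ FY) => h _ _; apply: h => //; exact: XY.
    by exists X => //; case: (FP _ FX) => h _ _; apply: h => //; exact: YX.
  - by move=> t x Tt [X FX Xx]; exists X => //; case: (FP _ FX) => _ h _; exact: h.
  - by move=> x [X FX Xx]; case: (FP _ FX) => _ _; exact.
have maxP (B : set A) : P B -> (forall x, N x -> B x) -> forall x, B x -> N x.
  move=> PB NB x Bx; apply: contrapT => nNx; apply: (Nmax B) => //.
  by split; [exact: NB | move=> /(_ x Bx)].
have N0 : N 0.
  apply: (maxP (fun x => x = 0 \/ N x)); [split | by right | by left].
  - move=> x y [->|Nx] [->|Ny]; rewrite ?addr0 ?add0r; [by left | by right | by right |].
    by right; exact: ND.
  - by move=> t x Tt [->|Nx]; [left; rewrite mulr0 | right; exact: NM].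
  - by move=> x [//|Nx]; exact: NV.
have hN : submodule T N by [].
exists N; split=> // a; apply: contrapT => na.
pose Q x := exists2 v, V v & N (x - v).
have hQ : submodule T Q.
  split; first by exists 0; rewrite ?subr0.
  - move=> x y [v Vv Nv] [w Vw Nw]; exists (v + w); first exact: VD.
    by rewrite opprD addrACA; exact: ND.
  - by move=> t x Tt [v Vv Nv]; exists (t * v); [exact: VM | rewrite -mulrBr; exact: NM].
(* The idempotent [f] generates the ideal of all [t] with [t * a] in [V + N]. After splitting off
   [f * a], the rest [b = (1 - f) * a] has no nonzero multiple in [V + N], so adjoining it to [N]
   keeps the intersection with [V] trivial. *)
have [||f [Tf fa] fP] := igT (fun t => T t /\ Q (t * a)).
- case: hQ => Q0 QD QM; split.
  + by split; [exact: subring0 | rewrite mul0r].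
  + by move=> x y [Tx Qx] [Ty Qy]; split; [exact: subringD | rewrite mulrDl; exact: QD].
  + by move=> t x Tt [Tx Qx]; split; [exact: TM | rewrite -mulrA; exact: QM].
- by move=> x [].
have T1f : T (1 - f) by exact: TB.
pose b := (1 - f) * a.
have bP t : T t -> Q (t * b) -> t * b = 0.
  move=> Tt; rewrite /b mulrA => Qtb.
  have := fP (t * (1 - f)) (conj (TM _ _ Tt T1f) Qtb).
  rewrite -mulrA [(1 - f) * f]mulrBl mul1r fP // subrr mulr0 => <-.
  by rewrite mul0r.
have NQ x : N x -> Q x by exists 0; rewrite ?subr0.
have Nb : N b.
  apply: (maxP (fun x => exists2 t, T t & N (x - t * b))).
  - split.
    + move=> x y [t Tt Nt] [u Tu Nu]; exists (t + u); first exact: subringD.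
      by rewrite mulrDl opprD addrACA; exact: ND.
    + move=> t x Tt [u Tu Nu]; exists (t * u); first exact: TM.
      by rewrite -mulrA -mulrBr; exact: NM.
    + move=> x [t Tt Nt] Vx.
      have tb0 : t * b = 0.
        apply: bP => //; exists x => //.
        by rewrite -opprB; exact: submoduleN hN Nt.
      by apply: NV => //; move: Nt; rewrite tb0 subr0.
  - by move=> x Nx; exists 0; [exact: subring0 | rewrite mul0r subr0].
  - by exists 1; rewrite // mul1r subrr.
apply: na; case: hQ => _ QD _.
have -> : a = b + f * a by rewrite /b; ring.
by apply: QD => //; exact: NQ.
Qed.

(** [F] is the projection along a complement of [V]; its linearity comes from uniqueness of the
    decomposition. *)
Lemma idempotent_generated_retraction T V :
  is_subring T -> idempotent_generated T -> submodule T V ->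
  exists F : A -> A, [/\ forall x y, F (x + y) = F x + F y,
    forall t x, T t -> F (t * x) = t * F x, forall x, V (F x) &
    forall x, V x -> F x = x].
Proof.
move=> hT igT hV.
have [W [hW WV WT]] := idempotent_generated_complement hT igT hV.
have [F FP] := @choice _ _ (fun x v => V v /\ W (x - v)) (fun x =>
  let: ex_intro2 v h h' := WT x in ex_intro _ v (conj h h')).
case: (hV) => V0 VD VM; case: (hW) => W0 WD WM.
have uniq x v : V v -> W (x - v) -> F x = v.
  move=> Vv Wv; have [VF WF] := FP x.
  apply/eqP; rewrite -subr_eq0; apply/eqP; apply: WV; last exact: submoduleB hV _ _.
  have -> : F x - v = (x - v) - (x - F x) by ring.
  exact: submoduleB hW _ _.
exists F; split.
- move=> x y; have [Vx Wx] := FP x; have [Vy Wy] := FP y.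
  by apply: uniq; [exact: VD | rewrite opprD addrACA; exact: WD].
- move=> t x Tt; have [Vx Wx] := FP x.
  by apply: uniq; [exact: VM | rewrite -mulrBr; exact: WM].
- by move=> x; case: (FP x).
- by move=> x Vx; apply: uniq; rewrite ?subrr.
Qed.

Definition spanned T (w : seq A) (x : A) : Prop :=
  exists2 c : nat -> A, forall i, T (c i) & x = \sum_(i < size w) c i * w`_i.

Lemma submodule_spanned T w : is_subring T -> submodule T (spanned T w).
Proof.
move=> hT; case: (hT) => T1 TB TM; split.
- exists (fun=> 0) => [_|]; first exact: subring0.
  by rewrite big1 // => i _; rewrite mul0r.
- move=> _ _ [c Tc ->] [d Td ->]; exists (fun i => c i + d i) => [i|].
    exact: subringD.
  by rewrite -big_split; apply: eq_bigr => i _; rewrite mulrDl.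
- move=> t _ Tt [c Tc ->]; exists (fun i => t * c i) => [i|]; first exact: TM.
  by rewrite mulr_sumr; apply: eq_bigr => i _; rewrite mulrA.
Qed.

Lemma spanned_mem T w x : is_subring T -> x \in w -> spanned T w x.
Proof.
move=> hT xw; case: (hT) => T1 _ _.
exists (fun i => (i == index x w)%:R) => [i|].
  by case: eqP => _ //; exact: subring0.
have iw : (index x w < size w)%N by rewrite index_mem.
rewrite (bigD1 (Ordinal iw)) //= eqxx mul1r nth_index // big1 ?addr0 // => i.
by rewrite -val_eqE /= => /negPf->; rewrite mul0r.
Qed.

Lemma spanned_cons T w a x :
  spanned T (a :: w) x <-> exists t y, [/\ T t, spanned T w y & x = t * a + y].
Proof.
split=> [[c Tc ->]|[t [y [Tt [c Tc ->] ->]]]].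
  exists (c 0%N), (\sum_(i < size w) c i.+1 * w`_i); split=> //.
    by exists (fun i => c i.+1).
  by rewrite big_ord_recl.
exists (fun i => if i is j.+1 then c j else t) => [[|i] //|].
by rewrite big_ord_recl.
Qed.

(** Induction on [w]. Within a descending chain, a submodule is controlled by its intersection with
    the span of the tail and by the ideal of possible coefficients of [a]; both stabilise. *)
Lemma dcc_spanned T w : is_subring T -> dcc T T -> dcc T (spanned T w).
Proof.
move=> hT dccT; elim: w => [|a w IH] I hI Iw Idec.
  exists 0%N => n _ x I0x; have [c _ ->] := Iw _ _ I0x.
  by rewrite big_ord0; case: (hI n).
have hw := submodule_spanned w hT; case: (hw) => w0 wD wM.
have [N1 N1P] := IH (fun n x => I n x /\ spanned T w x)
  (fun n => ltac:(case: (hI n) => I0 ID IM; split=> //;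
     [by move=> x y [? ?] [? ?]; split; [exact: ID | exact: wD]
     |by move=> t x Tt [? ?]; split; [exact: IM | exact: wM]]))
  (fun n x h => proj2 h)
  (fun n x h => conj (Idec n x (proj1 h)) (proj2 h)).
have [N2 N2P] := dccT (fun n t => T t /\ exists2 y, spanned T w y & I n (t * a + y))
  (fun n => ltac:(case: (hI n) => I0 ID IM; case: (hT) => T1 TB TM; split;
     [by split; [exact: subring0 | exists 0; rewrite ?mul0r ?addr0]
     |by move=> x y [Tx [u wu Iu]] [Ty [v wv Iv]]; split; [exact: subringD
       | exists (u + v); [exact: wD | rewrite mulrDl addrACA; exact: ID]]
     |by move=> t x Tt [Tx [u wu Iu]]; split; [exact: TM
       | exists (t * u); [exact: wM | rewrite -mulrA -mulrDr; exact: IM]]]))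
  (fun n x h => proj1 h)
  (fun n x h => conj (proj1 h) (let: ex_intro2 y wy Iy := proj2 h in
     ex_intro2 _ _ y wy (Idec _ _ Iy))).
have Ile m n : (m <= n)%N -> forall x, I n x -> I m x.
  by move=> /subnK<-; elim: (n - m)%N => [//|d IHd] x /Idec/IHd.
exists (maxn N1 N2) => n; rewrite geq_max => /andP[N1n N2n] x Ix.
have [t [y [Tt wy xE]]] := (spanned_cons _ _ _ _).1 (Iw _ _ Ix).
have [|_ [z wz Iz]] := N2P n N2n t.
  by split=> //; exists y => //; rewrite -xE; apply: Ile Ix; rewrite leq_maxr.
have [ID IM] : (forall x y, I n x -> I n y -> I n (x + y)) /\
  (forall t x, T t -> I n x -> I n (t * x)) by case: (hI n).
(* The element [t * a + z] of [I n] has the same leading coefficient as [x], so the difference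
   [y - z] lies in the span of [w] and in [I N1], hence in [I n]. *)
have -> : x = (t * a + z) + (y - z) by rewrite xE; ring.
apply: ID => //.
apply: (proj1 (N1P n N1n _ (conj _ _))); last exact: submoduleB hw _ _.
have -> : y - z = x - (t * a + z) by rewrite xE; ring.
apply: (submoduleB hT (hI N1)); first by apply: Ile Ix; rewrite leq_maxl.
exact: Ile Iz.
Qed.

End Submodules.

(** * Rings all of whose ideals are generated by idempotents *)

Notation whole A := (fun _ : A => True).

(** The ideal of [a] contains some [f = s * a] with [a * f = a], whence
    [a = a * f ^+ n = a * s ^+ n * a ^+ n]. *)
Lemma idempotent_generated_reduced (A : comPzRingType) :
  idempotent_generated (whole A) -> forall (a : A) n, a ^+ n = 0 -> a = 0.
Proof.
move=> igA a n an0.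
have [|//|f [s _ fE] fP] := igA (fun x => exists2 t, True & x = t * a).
  exact: submodule_principal.
have af m : a * f ^+ m = a.
  elim: m => [|m IH]; first by rewrite expr0 mulr1.
  by rewrite exprSr mulrA IH; apply: fP; exists 1; rewrite ?mul1r.
by rewrite -(af n) fE exprMn an0 mulr0 mulr0.
Qed.

(** If infinitely many idempotents lie below [f], a proper splitting [f = e + (f - e)] has a part
    with the same defect. This produces a strictly decreasing sequence of idempotents, which the
    generator of one suitable ideal rules out. *)
Lemma idempotents_finite (B : comPzRingType) :
  idempotent_generated (whole B) ->
  exists L : seq B, forall f, f * f = f -> f \in L.
Proof.
move=> igB.
pose good f := exists L : seq B, forall g, g * g = g -> g * f = g -> g \in L.
suff [L LP] : good 1 by exists L => f ff; apply: LP; rewrite ?mulr1.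
apply: contrapT => bad1.
have step (f : {f | f * f = f /\ ~ good f}) : exists f' : {f | f * f = f /\ ~ good f},
    sval f' * sval f = sval f' /\ sval f' <> sval f.
  case: f => f [ff badf] /=.
  have [e [ee ef e0 nef]] : exists e, [/\ e * e = e, e * f = e, e <> 0 & e <> f].
    apply: contrapT => h; apply: badf; exists [:: 0; f] => g gg gf.
    rewrite !inE; apply/orP; apply: contrapT => ng; apply: h; exists g.
    by split=> // gE; apply: ng; rewrite gE eqxx; [left | right].
  have ee' : (f - e) * (f - e) = f - e.
    have -> : (f - e) * (f - e) = f * f - e * f - e * f + e * e by ring.
    by rewrite ff ef ee subrK.
  have ef' : (f - e) * f = f - e by rewrite mulrBl ff ef.
  have [[L LP]|bade] := pselect (good e); last by exists (exist _ e (conj ee bade)).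
  have [[L' LP']|bade'] := pselect (good (f - e)); last first.
    exists (exist _ (f - e) (conj ee' bade')); split=> //= h.
    by apply: e0; rewrite -[e](subKr f) h subrr.
  case: badf; exists [seq x + y | x <- L, y <- L'] => g gg gf.
  have -> : g = g * e + g * (f - e) by rewrite -mulrDr addrC subrK.
  apply: allpairs_f.
    by apply: LP; [rewrite mulrACA gg ee | rewrite -mulrA ee].
  by apply: LP'; [rewrite mulrACA gg ee' | rewrite -mulrA ee'].
have [nx nxP] := choice step.
pose t n := iter n nx (exist _ 1 (conj (mulr1 1) bad1)).
pose s n := sval (t n).
have ss n : s n * s n = s n by case: (svalP (t n)).
have sS n : s n.+1 * s n = s n.+1 by case: (nxP (t n)).
have sle m n : (m <= n)%N -> s n * s m = s n.
  move=> /subnK<-; elim: (n - m)%N => [|d IH]; first exact: ss.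
  by rewrite addSn -[in LHS]sS -mulrA IH sS.
(* The ideal is the union of the annihilators of the [s n]. Its generator [h] is killed by a single
   [s n], and so is [1 - s n.+1], a multiple of [h]; this forces [s n.+1 = s n]. *)
have [|//|h [n hn] hP] := igB (fun x => exists n, x * s n = 0).
  split; first by exists 0%N; rewrite mul0r.
  - move=> x y [m xm] [n yn]; exists (maxn m n).
    rewrite mulrDl -(sle _ _ (leq_maxl m n)) mulrCA xm mulr0 add0r.
    by rewrite (sle _ _ (leq_maxl m n)) -(sle _ _ (leq_maxr m n)) mulrCA yn mulr0.
  - by move=> u x _ [m xm]; exists m; rewrite -mulrA xm mulr0.
have := hP (1 - s n.+1) (ex_intro _ n.+1 _).
rewrite mulrBl mul1r ss subrr => /(_ erefl) /(congr1 (fun x => x * s n)).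
rewrite -mulrA hn mulr0 mulrBl mul1r sS => /esym/eqP; rewrite subr_eq0 => /eqP.
by move=> /esym; case: (nxP (t n)).
Qed.

(** * Balanced maps and the tensor square *)

(** These are the maps that factor additively through the tensor product over [k]. No action of [k]
    on the target [M] is assumed. *)
Definition balanced (A : comPzRingType) (k : A -> Prop) (M : zmodType)
    (b : A -> A -> M) : Prop :=
  [/\ forall x y z, b (x + y) z = b x z + b y z,
      forall x y z, b x (y + z) = b x y + b x z &
      forall r x y, k r -> b (r * x) y = b x (r * y)].

Lemma balanced0 (A : comPzRingType) (k : A -> Prop) (M : zmodType)
  (b : A -> A -> M) y : balanced k b -> b 0 y = 0.
Proof. by case=> bD _ _; apply: (@addrI _ (b 0 y)); rewrite -bD !addr0. Qed.

Lemma balancedN (A : comPzRingType) (k : A -> Prop) (M : zmodType)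
  (b : A -> A -> M) x y : balanced k b -> b (- x) y = - b x y.
Proof.
move=> hb; case: (hb) => bD _ _; apply: (@addIr _ (b x y)).
by rewrite -bD !addNr (balanced0 _ hb).
Qed.

(* [B] is a model of the tensor product of [A] with itself over [k], made of
   formal sums identified when no balanced map tells them apart. *)
Lemma tensor_square (A : comPzRingType) (k : A -> Prop) :
  exists (B : comPzRingType) (i1 i2 : {rmorphism A -> B}),
    [/\ forall r, k r -> i1 r = i2 r,
        forall b, exists l : seq (A * A), b = \sum_(p <- l) i1 p.1 * i2 p.2 &
        forall (M : zmodType) (b : A -> A -> M), balanced k b ->
          exists h : {additive B -> M}, forall x y, h (i1 x * i2 y) = b x y].
Proof.
pose X : choiceType := seq (A * A).
pose ev (M : zmodType) (b : A -> A -> M) (l : X) := \sum_(p <- l) b p.1 p.2.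
pose e (l l' : X) := forall (M : zmodType) (b : A -> A -> M),
  balanced k b -> ev M b l = ev M b l'.
pose opp (l : X) : X := [seq (- p.1, p.2) | p <- l].
pose mul (l l' : X) : X := [seq (p.1 * q.1, p.2 * q.2) | p <- l, q <- l'].
have evN (M : zmodType) (b : A -> A -> M) l : balanced k b ->
    ev M b (opp l) = - ev M b l.
  move=> hb; rewrite /ev big_map -sumrN; apply: eq_bigr => p _ /=.
  exact: balancedN hb.
have evM (M : zmodType) (b : A -> A -> M) l l' :
    ev M b (mul l l') = \sum_(p <- l) \sum_(q <- l') b (p.1 * q.1) (p.2 * q.2).
  by rewrite /ev big_allpairs_dep.
have evC (M : zmodType) (b : A -> A -> M) l l' : ev M b (mul l l') = ev M b (mul l' l).
  rewrite !evM exchange_big; apply: eq_bigr => p _; apply: eq_bigr => q _.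
  by rewrite mulrC [q.2 * _]mulrC.
(* For a fixed term [p] of [x], multiplying both arguments of [b] by the components of [p] gives
   again a balanced map, to which [e y y'] applies. *)
have evM2 x y y' : e y y' -> e (mul x y) (mul x y').
  move=> h M b [bDl bDr bM]; rewrite !evM; apply: eq_bigr => p _.
  apply: (h _ (fun u v => b (p.1 * u) (p.2 * v))); split.
  - by move=> u v w; rewrite mulrDr bDl.
  - by move=> u v w; rewrite mulrDr bDr.
  - by move=> r u v kr /=; rewrite mulrCA (bM r) // [r * (p.2 * v)]mulrCA.
have [B [p [surj pE pD pM p1]]] : exists (B : comPzRingType) (p : X -> B),
  [/\ forall q, exists x, q = p x, forall x y, p x = p y <-> e x y,
    forall x y : X, p (x ++ y) = p x + p y, forall x y, p (mul x y) = p x * p y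
    & p [:: (1, 1)] = 1].
  apply: (setoid_ring_quotient (zero := [::]) (opp := opp)).
  - by [].
  - by move=> x y h M b hb; rewrite h.
  - by move=> y x z h h' M b hb; rewrite h // h'.
  - by move=> x x' h M b hb; rewrite !evN // h.
  - by move=> x x' y y' h h' M b hb; rewrite /ev !big_cat; congr (_ + _); [exact: h | exact: h'].
  - move=> x x' y y' h h' M b hb; rewrite (evM2 _ _ _ h') //.
    by rewrite evC (evM2 _ _ _ h) // evC.
  - by move=> x y z M b _; rewrite catA.
  - by move=> x y M b _; rewrite /ev !big_cat /= addrC.
  - by [].
  - by move=> x M b hb; rewrite /ev big_cat /= -!/(ev _ _ _) evN // addNr /ev big_nil.
  - move=> x y z M b _; rewrite !evM [RHS]big_allpairs_dep; apply: eq_bigr => u _.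
    by rewrite big_allpairs_dep; apply: eq_bigr => v _; apply: eq_bigr => w _; rewrite !mulrA.
  - by move=> x y M b _; rewrite evC.
  - move=> x M b _; rewrite evM big_seq1; apply: eq_bigr => u _.
    by rewrite !mul1r.
  - by move=> x y z M b _; rewrite /ev big_cat /= -!/(ev _ _ _) !evM big_cat.
have pB (f : A -> X) : (forall x y, e (f (x + y)) (f x ++ f y)) ->
    zmod_morphism (fun a => p (f a)).
  by move=> h x y; apply: (@addIr _ (p (f y))); rewrite -pD !subrK; apply/pE => M b hb;
     rewrite -h // subrK.
have i1B : zmod_morphism (fun a => p [:: (a, 1)]).
  apply: (pB (fun a => [:: (a, 1)])) => x y M b [bD _ _].
  by rewrite /ev /= big_seq1 big_cons big_seq1 /= bD.
have i2B : zmod_morphism (fun a => p [:: (1, a)]).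
  apply: (pB (fun a => [:: (1, a)])) => x y M b [_ bD _].
  by rewrite /ev /= big_seq1 big_cons big_seq1 /= bD.
have i1M : monoid_morphism (fun a => p [:: (a, 1)]).
  by split=> // x y; rewrite -pM /mul /= mulr1.
have i2M : monoid_morphism (fun a => p [:: (1, a)]).
  by split=> // x y; rewrite -pM /mul /= mulr1.
pose i1 : {rmorphism A -> B} := HB.pack (fun a => p [:: (a, 1)])
  (GRing.isZmodMorphism.Build A B _ i1B) (GRing.isMonoidMorphism.Build A B _ i1M).
pose i2 : {rmorphism A -> B} := HB.pack (fun a => p [:: (1, a)])
  (GRing.isZmodMorphism.Build A B _ i2B) (GRing.isMonoidMorphism.Build A B _ i2M).
have i12 x y : i1 x * i2 y = p [:: (x, y)].
  by rewrite -[LHS]pM /mul /= mulr1 mul1r.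
have p0 : p [::] = 0 by apply: (@addrI _ (p [::])); rewrite -pD addr0.
have pl l : p l = \sum_(q <- l) i1 q.1 * i2 q.2.
  elim: l => [|[x y] l IH]; first by rewrite big_nil.
  by rewrite big_cons -IH i12 -pD.
exists B, i1, i2; split.
- move=> r kr; apply/pE => M b [_ _ bM].
  by rewrite /ev !big_seq1 /= -[r in LHS]mulr1 bM // mulr1.
- by move=> b; have [l ->] := surj b; exists l; exact: pl.
move=> M b hb; have [s sP] := choice surj.
pose h x := ev M b (s x).
have hp l : h (p l) = ev M b l by apply: (pE _ _).1 => //; rewrite -sP.
have hB : zmod_morphism h.
  move=> x y; apply: (@addIr _ (h y)); rewrite subrK.
  have [l lE] := surj (x - y); have [l' yE] := surj y.
  have xE : x = p (l ++ l') by rewrite pD -lE -yE subrK.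
  by rewrite lE xE yE !hp /ev big_cat.
pose ha : {additive B -> M} := HB.pack h (GRing.isZmodMorphism.Build B M h hB).
by exists ha => x y; rewrite i12 [LHS]hp /ev big_seq1.
Qed.

(** * Separable algebras *)

Section Separable.
Variables (A : comPzRingType) (k : A -> Prop).

(* The pairs in [l] are the terms of a separability idempotent of [A] over [k]. *)
Definition separable : Prop :=
  exists l : seq (A * A), \sum_(p <- l) p.1 * p.2 = 1 /\
    forall (M : zmodType) (b : A -> A -> M), balanced k b -> forall a,
      \sum_(p <- l) b (a * p.1) p.2 = \sum_(p <- l) b p.1 (a * p.2).

(* Any two [k]-algebra maps to [E] that agree modulo an ideal [I] agree
   modulo [I ^+ 2]. *)
Definition formally_unramified : Prop :=
  forall (E : comPzRingType) (f g : {rmorphism A -> E}),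
    (forall r, k r -> f r = g r) ->
    forall I J : E -> Prop, submodule (whole E) I -> submodule (whole E) J ->
      (forall a, I (f a - g a)) -> (forall x y, I x -> I y -> J (x * y)) ->
      forall a, J (f a - g a).

(* If [I] is the kernel of the multiplication of [A (x) A], the determinant
   trick turns [I = I ^+ 2] into an element [e] that is killed by [I] and
   congruent to [1] modulo [I]. *)
Lemma formally_unramified_separable :
  finite_type k -> formally_unramified -> separable.
Proof.
move=> [g gP] ur; have [B [i1 [i2 [i12 Bl Bh]]]] := tensor_square k.
pose D a := i1 a - i2 a; pose n := size g; pose d (j : 'I_n) := D g`_j.
pose I x := exists c : 'I_n -> B, x = \sum_j c j * d j.
(* [I] is the ideal generated by the [d j], and [J] is its square, written so that membership of
   [d j] directly yields a row of coefficients in [I]. *)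
pose J x := exists2 c : 'I_n -> B, forall j, I (c j) & x = \sum_j c j * d j.
have hI : submodule (whole B) I.
  split; first by exists (fun=> 0); rewrite big1 // => j _; rewrite mul0r.
  - move=> _ _ [c ->] [c' ->]; exists (fun j => c j + c' j).
    by rewrite -big_split; apply: eq_bigr => j _; rewrite mulrDl.
  - move=> t _ _ [c ->]; exists (fun j => t * c j).
    by rewrite mulr_sumr; apply: eq_bigr => j _; rewrite mulrA.
have [I0 ID IM] := hI.
have hJ : submodule (whole B) J.
  split; first by exists (fun=> 0) => //; rewrite big1 // => j _; rewrite mul0r.
  - move=> _ _ [c Ic ->] [c' Ic' ->]; exists (fun j => c j + c' j) => [j|].
      exact: ID.
    by rewrite -big_split; apply: eq_bigr => j _; rewrite mulrDl.
  - move=> t _ _ [c Ic ->]; exists (fun j => t * c j) => [j|]; first exact: IM.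
    by rewrite mulr_sumr; apply: eq_bigr => j _; rewrite mulrA.
have IJ x y : I x -> I y -> J (x * y).
  move=> [c ->] Iy; exists (fun j => c j * y) => [j|]; first exact: IM.
  by rewrite mulr_suml; apply: eq_bigr => j _; rewrite mulrAC.
(* The elements [a] with [D a] in [I] form a subalgebra that contains the generators. *)
have DI a : I (D a).
  apply: (gP a (fun a => I (D a))) => [|x xg]; last first.
    have xn : (index x g < n)%N by rewrite index_mem.
    exists (fun j => (j == Ordinal xn)%:R); rewrite (bigD1 (Ordinal xn)) //=.
    rewrite eqxx mul1r /d nth_index // big1 ?addr0 // => i /negPf->.
    by rewrite mul0r.
  split; last by move=> r kr; rewrite /D i12 // subrr.
  split; first by rewrite /D !rmorph1 subrr.
  - move=> x y Ix Iy; have -> : D (x - y) = D x - D y by rewrite /D !rmorphB; ring.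
    exact: submoduleB hI Ix Iy.
  - move=> x y Ix Iy.
    have -> : D (x * y) = i1 x * D y + i2 y * D x by rewrite /D !rmorphM; ring.
    by apply: ID; exact: IM.
have Jd j : exists c : 'I_n -> B, (forall i, I (c i)) /\ d j = \sum_i c i * d i.
  by have [c Ic dE] := ur _ i1 i2 i12 I J hI hJ DI IJ g`_j; exists c.
have [N NP] := choice Jd.
have hm : balanced k (fun x y : A => x * y).
  by split=> [x y z|x y z|r x y _]; rewrite ?mulrDl ?mulrDr // -mulrA mulrCA.
(* The universal property yields multiplication only as an additive map; that it is a ring morphism
   is checked on sums of pure tensors. *)
have [m mP] := Bh _ _ hm.
have mM : monoid_morphism m.
  split; first by rewrite -[1]mulr1 -{1}(rmorph1 i1) -(rmorph1 i2) mP mulr1.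
  move=> x y; have [l ->] := Bl x; have [l' ->] := Bl y.
  rewrite big_distrl /= !raddf_sum big_distrl /=; apply: eq_bigr => p _.
  rewrite big_distrr /= !raddf_sum big_distrr /=; apply: eq_bigr => q _.
  by rewrite mulrACA -!rmorphM !mP mulrACA.
pose mu : {rmorphism B -> A} := HB.pack (m : B -> A) m
  (GRing.isMonoidMorphism.Build B A m mM).
have muE x y : mu (i1 x * i2 y) = x * y by exact: mP.
have mud j : mu (d j) = 0.
  have := muE g`_j 1; rewrite rmorph1 !mulr1 => h1.
  have := muE 1 g`_j; rewrite rmorph1 !mul1r => h2.
  by rewrite rmorphB h1 h2 subrr.
have muI x : I x -> mu x = 0.
  by move=> [c ->]; rewrite rmorph_sum big1 // => j _; rewrite rmorphM mud mulr0.
pose Q : 'M[B]_n := 1%:M - \matrix_(i, j) N i j.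
have Qd : Q *m (\col_j d j) = 0.
  apply/matrixP => i j; rewrite mulmxBl mul1mx !mxE [in X in X - _](proj2 (NP i)).
  by apply/eqP; rewrite subr_eq0; apply/eqP; apply: eq_bigr => u _; rewrite !mxE.
have ed j : \det Q * d j = 0.
  have := congr1 (mulmx (\adj Q)) Qd.
  rewrite mulmxA mul_adj_mx mulmx0 mul_scalar_mx => /matrixP/(_ j ord0).
  by rewrite !mxE.
(* The entries of [N] lie in [I], which [mu] kills, so [Q] maps to the identity matrix. *)
have mue : mu (\det Q) = 1.
  rewrite -det_map_mx map_mxB map_mx1.
  have -> : map_mx mu (\matrix_(i, j) N i j) = 0.
    by apply/matrixP => i j; rewrite !mxE muI //; case: (NP i).
  by rewrite subr0 det1.
have eD a : \det Q * D a = 0.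
  have [c ->] := DI a; rewrite mulr_sumr big1 // => j _.
  by rewrite mulrCA ed mulr0.
have [l lE] := Bl (\det Q); exists l; split.
  by rewrite -mue lE rmorph_sum; apply: eq_bigr => p _; rewrite muE.
move=> M b hb a; have [h hP] := Bh _ _ hb; apply/eqP; rewrite -subr_eq0 -sumrB.
have := congr1 h (eD a); rewrite lE mulr_suml raddf_sum raddf0 => h0.
apply/eqP; rewrite -[RHS]h0; apply: eq_bigr => p _; rewrite -!hP -raddfB !rmorphM.
by congr (h _); rewrite /D; ring.
Qed.

Hypotheses (hk : is_subring k) (igk : idempotent_generated k) (sepA : separable).

(* [a = a * \sum p q = \sum F (a p) q] for a [k]-linear retraction [F] onto
   the span of the first components. *)
Lemma separable_finite : exists w, forall a, spanned k w a.
Proof.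
have [l [l1 lP]] := sepA.
have [F [FD FM FV FK]] := idempotent_generated_retraction hk igk
  (submodule_spanned [seq p.1 | p <- l] hk).
exists [seq p.1 * q.2 | p <- l, q <- l] => a.
have hw := submodule_spanned [seq p.1 * q.2 | p <- l, q <- l] hk.
have hb : balanced k (fun x y => F x * y).
  split=> [x y z|x y z|r x y kr]; rewrite ?FD ?mulrDl ?mulrDr //.
  by rewrite FM // mulrCA mulrA.
have -> : a = \sum_(p <- l) F (a * p.1) * p.2.
  rewrite (lP _ _ hb) -[LHS]mulr1 -l1 mulr_sumr !big_seq; apply: eq_bigr => p pl.
  rewrite FK; first by rewrite mulrCA.
  by apply: spanned_mem => //; exact: map_f.
apply: (submodule_sum_in hw) => q ql.
have [c kc ->] := FV (a * q.1); rewrite mulr_suml.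
apply: (submodule_sum _ hw) => i _; rewrite -mulrA; case: (hw) => _ _; apply => //.
have il : (i < size l)%N by rewrite -(size_map fst) ltn_ord.
rewrite (nth_map (0, 0)) //; apply: spanned_mem => //.
by apply: (allpairs_f (fun p q : A * A => p.1 * q.2)) => //; exact: mem_nth.
Qed.

(** With [F] a [k]-linear retraction onto [I], put [f = \sum F p * q]. Separability moves a factor
    [x] of [I] inside [F], giving [x * f = \sum F (x * p) * q = \sum x * p * q = x]. *)
Lemma separable_idempotent_generated : idempotent_generated (whole A).
Proof.
move=> I hI _; have [l [l1 lP]] := sepA; case: (hI) => I0 ID IM.
have hkI : submodule k I by split=> // t x _; exact: IM.
have [F [FD FM FV FK]] := idempotent_generated_retraction hk igk hkI.
have hb : balanced k (fun x y => F x * y).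
  split=> [x y z|x y z|r x y kr]; rewrite ?FD ?mulrDl ?mulrDr //.
  by rewrite FM // mulrCA mulrA.
exists (\sum_(p <- l) F p.1 * p.2).
  by apply: (submodule_sum _ hI) => p _; rewrite mulrC; exact: IM.
move=> x Ix; transitivity (\sum_(p <- l) F p.1 * (x * p.2)).
  by rewrite mulr_sumr; apply: eq_bigr => p _; rewrite mulrCA.
rewrite -(lP _ _ hb) -[RHS]mulr1 -l1 mulr_sumr; apply: eq_bigr => p _.
by rewrite FK ?mulrA // mulrC; exact: IM.
Qed.

End Separable.

(** * Images under ring morphisms and separability of the tensor square *)

Definition image_of (A B : Type) (f : A -> B) (P : A -> Prop) (y : B) : Prop :=
  exists2 x, P x & y = f x.

Section Image.
Variables (A B : comPzRingType) (f : {rmorphism A -> B}).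

Lemma subring_image T : is_subring T -> is_subring (image_of f T).
Proof.
case=> T1 TB TM; split; first by exists 1; rewrite ?rmorph1.
  by move=> _ _ [x Tx ->] [y Ty ->]; exists (x - y); [exact: TB | rewrite rmorphB].
by move=> _ _ [x Tx ->] [y Ty ->]; exists (x * y); [exact: TM | rewrite rmorphM].
Qed.

Lemma idempotent_generated_image T :
  is_subring T -> idempotent_generated T -> idempotent_generated (image_of f T).
Proof.
move=> hT igT I [I0 ID IM] IT; case: (hT) => T1 TB TM.
have [||g [Tg Ig] gP] := igT (fun t => T t /\ I (f t)).
- split; first by rewrite rmorph0; split=> //; exact: subring0.
  + move=> x y [Tx Ix] [Ty Iy]; split; first exact: subringD.
    by rewrite rmorphD; exact: ID.
  + move=> t x Tt [Tx Ix]; split; first exact: TM.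
    by rewrite rmorphM; apply: IM => //; exists t.
- by move=> x [].
exists (f g) => // y Iy; have [x Tx yE] := IT _ Iy.
by rewrite yE -rmorphM gP // -yE.
Qed.

End Image.

(* The product of the two pullbacks of a separability idempotent of [A]. *)
Lemma tensor_square_separable (A B : comPzRingType) (k : A -> Prop)
    (i1 i2 : {rmorphism A -> B}) :
  (forall r, k r -> i1 r = i2 r) ->
  (forall b, exists l : seq (A * A), b = \sum_(p <- l) i1 p.1 * i2 p.2) ->
  separable k -> separable (image_of i1 k).
Proof.
move=> i12 Bl [l [l1 lP]].
exists [seq (i1 p.1 * i2 q.1, i1 p.2 * i2 q.2) | p <- l, q <- l].
split.
  rewrite big_allpairs_dep /=.
  transitivity (i1 (\sum_(p <- l) p.1 * p.2) * i2 (\sum_(p <- l) p.1 * p.2)).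
    rewrite !rmorph_sum mulr_suml; apply: eq_bigr => p _.
    by rewrite mulr_sumr; apply: eq_bigr => q _; rewrite !rmorphM mulrACA.
  by rewrite l1 !rmorph1 mulr1.
move=> M b hb; case: (hb) => bDl bDr bM.
have b0r x : b x 0 = 0 by apply: (@addrI _ (b x 0)); rewrite -bDr !addr0.
(* The spectator factors [u] and [v] make [ok] stable under products; sums are immediate, so only
   the images of [i1] and [i2] have to be treated. *)
pose ok a := forall u v,
  \sum_(p <- l) \sum_(q <- l) b (a * u * (i1 p.1 * i2 q.1)) (v * (i1 p.2 * i2 q.2)) =
  \sum_(p <- l) \sum_(q <- l) b (u * (i1 p.1 * i2 q.1)) (a * v * (i1 p.2 * i2 q.2)).
suff okP : forall a, ok a.
  move=> a; have := okP a 1 1; rewrite mulr1 !big_allpairs_dep /= => h.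
  transitivity (\sum_(p <- l) \sum_(q <- l) b (a * (i1 p.1 * i2 q.1)) (1 * (i1 p.2 * i2 q.2))).
    by apply: eq_bigr => p _; apply: eq_bigr => q _; rewrite mul1r.
  by rewrite h; apply: eq_bigr => p _; apply: eq_bigr => q _; rewrite mul1r.
have ok1 a : ok (i1 a).
  move=> u v; rewrite exchange_big [RHS]exchange_big; apply: eq_bigr => q _ /=.
  have hq : balanced k (fun x y => b (u * (i1 x * i2 q.1)) (v * (i1 y * i2 q.2))).
    split=> [x y z|x y z|r x y kr].
    - by rewrite rmorphD mulrDl mulrDr bDl.
    - by rewrite rmorphD mulrDl mulrDr bDr.
    - have kr' : image_of i1 k (i1 r) by exists r.
      rewrite !rmorphM -[i1 r * _ * _]mulrA [u * (i1 r * _)]mulrCA (bM (i1 r)) //.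
      by rewrite -[i1 r * _ * _]mulrA [v * (i1 r * _)]mulrCA.
  transitivity (\sum_(p <- l) b (u * (i1 (a * p.1) * i2 q.1)) (v * (i1 p.2 * i2 q.2))).
    by apply: eq_bigr => p _; rewrite rmorphM; congr (b _ _); ring.
  by rewrite (lP _ _ hq a); apply: eq_bigr => p _; rewrite rmorphM; congr (b _ _); ring.
have ok2 a : ok (i2 a).
  move=> u v; apply: eq_bigr => p _ /=.
  have hq : balanced k (fun x y => b (u * (i1 p.1 * i2 x)) (v * (i1 p.2 * i2 y))).
    split=> [x y z|x y z|r x y kr].
    - by rewrite rmorphD !mulrDr bDl.
    - by rewrite rmorphD !mulrDr bDr.
    (* Scalars coming through the second factor are still scalars, since [i1] and [i2] agree on
       [k]. *)
    - have kr' : image_of i1 k (i2 r) by exists r => //; rewrite i12.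
      rewrite !rmorphM; have -> : u * (i1 p.1 * (i2 r * i2 x)) = i2 r * (u * (i1 p.1 * i2 x)) by ring.
      by rewrite (bM (i2 r)) //; congr (b _ _); ring.
  transitivity (\sum_(q <- l) b (u * (i1 p.1 * i2 (a * q.1))) (v * (i1 p.2 * i2 q.2))).
    by apply: eq_bigr => q _; rewrite rmorphM; congr (b _ _); ring.
  rewrite (lP _ _ hq a); apply: eq_bigr => q _; rewrite rmorphM; congr (b _ _); ring.
have okM x y : ok x -> ok y -> ok (x * y).
  move=> okx oky u v; rewrite -[x * y * u]mulrA okx.
  have -> : x * y * v = y * (x * v) by ring.
  by rewrite -oky.
have okD x y : ok x -> ok y -> ok (x + y).
  move=> okx oky u v.
  transitivity (\sum_(p <- l) \sum_(q <- l) b (x * u * (i1 p.1 * i2 q.1)) (v * (i1 p.2 * i2 q.2)) +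
    \sum_(p <- l) \sum_(q <- l) b (y * u * (i1 p.1 * i2 q.1)) (v * (i1 p.2 * i2 q.2))).
    rewrite -big_split; apply: eq_bigr => p _; rewrite -big_split; apply: eq_bigr => q _ /=.
    by rewrite -bDl !mulrDl.
  rewrite okx oky -big_split; apply: eq_bigr => p _; rewrite -big_split.
  by apply: eq_bigr => q _ /=; rewrite -bDr !mulrDl.
have ok0 : ok 0.
  move=> u v; apply: eq_bigr => p _; apply: eq_bigr => q _.
  by rewrite !mul0r (balanced0 _ hb) b0r.
move=> a; have [s ->] := Bl a; elim: s => [|p s IH]; first by rewrite big_nil.
by rewrite big_cons; apply: okD => //; apply: okM.
Qed.

(** * From differentials to formal unramifiedness *)

(** Grouping the terms by symbol shows that the pairing of a formal sum with [D] depends only on its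
    coefficient function, which is all that [kahler_zero] compares. *)
Lemma fsum_pairing (S E : comPzRingType) (f : {additive S -> E}) (D : S -> E)
    (u : seq S) (l : seq (S * S)) :
  uniq u -> (forall p, p \in l -> p.2 \in u) ->
  \sum_(p <- l) f p.1 * D p.2 = \sum_(x <- u) f (fsum l x) * D x.
Proof.
move=> uu lu; rewrite big_seq.
transitivity (\sum_(x <- u) \sum_(p <- l | (p \in l) && (p.2 == x)) f p.1 * D p.2).
  rewrite (exchange_big_dep (fun p => p \in l)) /=; last by move=> x p _ /andP[].
  apply: eq_bigr => p pl; rewrite -big_filter.
  have -> : [seq x <- u | (p \in l) && (p.2 == x)] = [:: p.2].
    rewrite pl -(filter_pred1_uniq uu (lu _ pl)); apply: eq_filter => x /=.
    by rewrite eq_sym.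
  by rewrite big_seq1.
apply: eq_bigr => x _; rewrite /fsum raddf_sum mulr_suml big_seq_cond.
rewrite [RHS]big_seq_cond; apply: eq_big => [p|p /andP[_ /andP[_ /eqP->]] //].
by rewrite andbA andbb.
Qed.

(** Modulo [J] the difference [D = f - g] is a derivation vanishing on [R], because its Leibniz
    defect is a multiple of [D a * D b]. Hence every relation among differentials pairs into [J],
    and so does [d s]. *)
Lemma kahler_zero_formally_unramified (S : comPzRingType) (R : S -> Prop) :
  kahler_zero R -> formally_unramified R.
Proof.
move=> kz E f g fgR I J hI hJ fgI IJ s; case: (hJ) => J0 JD JM.
pose D a := f a - g a.
have rel l : kahler_rel R l -> J (\sum_(p <- l) f p.1 * D p.2).
  elim=> [|c a b m _ IH|c a b m _ IH|c r m Rr _ IH]; first by rewrite big_nil.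
  - rewrite /fscale /= !big_cons /= !addrA; apply: (JD _ _ _ IH).
    suff -> : f (c * 1) * D (a + b) + f (c * -1) * D a + f (c * -1) * D b = 0 by [].
    by rewrite /D !rmorphM !rmorphD rmorphN rmorph1; ring.
  - rewrite /fscale /= !big_cons /= !addrA; apply: (JD _ _ _ IH).
    have -> : f (c * 1) * D (a * b) + f (c * - a) * D b + f (c * - b) * D a =
        - f c * (D a * D b).
      by rewrite /D !rmorphM !rmorphN rmorph1; ring.
    by apply: JM => //; exact: IJ (fgI a) (fgI b).
  - rewrite /fscale /= big_cons /=; apply: (JD _ _ _ IH).
    by rewrite /D (fgR r) // subrr mulr0.
have [l [lR lE]] := kz s.
(* One list has to carry the symbols of both formal sums, so that their pairings are compared term
   by term. *)
pose u := undup (s :: [seq p.2 | p <- l]).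
have uu : uniq u by exact: undup_uniq.
have := rel l lR; rewrite (fsum_pairing f D uu); last first.
  by move=> p pl; rewrite mem_undup inE map_f ?orbT.
under eq_bigr do rewrite lE.
rewrite -(fsum_pairing f D uu) ?big_seq1 /=; last first.
  by move=> p; rewrite inE => /eqP-> /=; rewrite mem_undup mem_head.
by rewrite rmorph1 mul1r.
Qed.

(* A subalgebra [T] is recovered from the ideal of [A (x) A] generated by the
   [t (x) 1 - 1 (x) t], [t] in [T], by means of a [T]-linear retraction
   [A -> T]; and [A (x) A] has only finitely many ideals. *)
Lemma separable_FIP (A : comPzRingType) (k : A -> Prop) :
  is_subring k -> dcc k k -> idempotent_generated k -> separable k -> FIP k.
Proof.
move=> hk dcck igk sepk.
have [B [i1 [i2 [i12 Bl Bh]]]] := tensor_square k.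
have sepB := tensor_square_separable i12 Bl sepk.
have igB := separable_idempotent_generated (subring_image i1 hk)
  (idempotent_generated_image (f := i1) hk igk) sepB.
have redA := idempotent_generated_reduced (separable_idempotent_generated hk igk sepk).
have [w wP] := separable_finite hk igk sepk.
have [L LP] := idempotents_finite igB.
pose D a := i1 a - i2 a.
exists [seq (fun a => D a * f = D a) | f <- L] => T [hT kT].
(* Submodules over [T] are submodules over [k], and [A] is finite over [k]. *)
have dccT : dcc T T.
  move=> I hI _ Idec; apply: (dcc_spanned (w := w) hk dcck) => // n.
  by case: (hI n) => I0 ID IM; split=> // t x /kT; exact: IM.
have igT := dcc_reduced_idempotent_generated hT dccT (fun t _ => redA t).
have [T1 TB TM] := hT.
have sT : submodule T T by split=> // *; [exact: subring0 | exact: subringD].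
have [F [FD FM FV FK]] := idempotent_generated_retraction hT igT sT.
pose J b := exists l : seq (B * A), (forall p, p \in l -> T p.2) /\
  b = \sum_(p <- l) p.1 * D p.2.
have [|//|f Jf fP] := igB J.
  split; first by exists [::]; rewrite big_nil.
  - move=> _ _ [l [lT ->]] [l' [lT' ->]]; exists (l ++ l'); rewrite big_cat.
    by split=> // p; rewrite mem_cat => /orP[/lT|/lT'].
  - move=> t _ _ [l [lT ->]]; exists [seq (t * p.1, p.2) | p <- l]; split.
      by move=> _ /mapP[p pl ->]; exact: (lT p pl).
    by rewrite big_map mulr_sumr; apply: eq_bigr => p _; rewrite mulrA.
exists (fun a => D a * f = D a).
  have : f \in L by apply: LP; exact: fP.
  elim: L {LP} => //= g L IH; rewrite inE => /orP[/eqP->|/IH]; first by left.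
  by right.
move=> a; split=> [Ta|Df].
  apply: fP; exists [:: (1, a)]; rewrite big_seq1 mul1r; split=> // p.
  by rewrite inE => /eqP->.
have hF : balanced k (fun x y => F x * y).
  split=> [x y z|x y z|r x y /kT Tr]; rewrite ?FD ?mulrDl ?mulrDr //.
  by rewrite FM // mulrCA mulrA.
have [h hP] := Bh _ _ hF.
(* Because [F] is [T]-linear, the map [h], which sends [x (x) y] to [F x * y], does not distinguish
   [t (x) 1] from [1 (x) t]. Applied to [D a] it gives [F a - a], so [a = F a] lies in [T]. *)
have hJ b : J b -> h b = 0.
  move=> [l [lT ->]]; rewrite raddf_sum big_seq big1 // => p /lT Tp.
  have [m ->] := Bl p.1; rewrite mulr_suml raddf_sum big1 // => q _.
  have -> : i1 q.1 * i2 q.2 * D p.2 =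
      i1 (p.2 * q.1) * i2 q.2 - i1 q.1 * i2 (p.2 * q.2).
    by rewrite /D !rmorphM; ring.
  by rewrite raddfB /= !hP FM // mulrCA mulrA subrr.
have JDa : J (D a).
  case: Jf => l [lT fE]; exists [seq (D a * p.1, p.2) | p <- l]; split.
    by move=> _ /mapP[p pl ->]; exact: (lT p pl).
  by rewrite -[LHS]Df fE big_map mulr_sumr; apply: eq_bigr => p _; rewrite mulrA.
have DaE : D a = i1 a * i2 1 - i1 1 * i2 a by rewrite !rmorph1 mulr1 mul1r.
have := hJ _ JDa; rewrite DaE raddfB /= !hP mulr1 (FK 1) // mul1r => /eqP.
by rewrite subr_eq0 => /eqP <-; exact: FV.
Qed.

(** * Reduction to the quotient by the conductor *)

Theorem theorem3p8 (S : comPzRingType) (R : S -> Prop) :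
  is_subring R -> unramified R -> gilmer R -> nucleus_reduced R ->
  finite_ext R /\ FIP R.
Proof.
move=> hR [[g gP] kz] artR redR; case: (hR) => R1 RB RM.
pose C := conductor R.
have [||| A [p [psurj pC]]] := @ideal_quotient S C.
- by split=> [|s]; rewrite ?mul0r; exact: subring0.
- move=> x y [Rx Cx] [Ry Cy]; split=> [|s]; first exact: subringD.
  by rewrite mulrDl; exact: subringD.
- move=> s x [Rx Cx]; split=> [|t]; first by rewrite mulrC.
  by rewrite [s * x]mulrC -mulrA.
have CR x : C x -> R x by case.
have pE x y : p x = p y -> C (x - y) by move=> h; apply/pC; rewrite rmorphB h subrr.
pose k := image_of p R.
have hk : is_subring k by exact: subring_image.
have dcck : dcc k k.
  move=> I hI Ik Idec.
  (* A chain of ideals of [k] is pulled back to a chain of ideals of [R] above the conductor. *)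
  have [n|n x [Rx Ix]|N NP] := artR (fun n x => R x /\ I n (p x)).
  - case: (hI n) => I0 ID IM; split.
    + by move=> x [].
    + by move=> x Cx; split; [exact: CR | rewrite ((pC x).2 Cx)].
    + by split; [exact: subring0 | rewrite rmorph0].
    + by move=> x y [Rx Ix] [Ry Iy]; split; [exact: subringD | rewrite rmorphD; exact: ID].
    + move=> r x Rr [Rx Ix]; split; first exact: RM.
      by rewrite rmorphM; apply: IM => //; exists r.
  - by split=> //; exact: Idec.
  exists N => n Nn y Iy; have [x Rx yE] := Ik _ _ Iy.
  by rewrite yE; apply: ((NP n Nn x).2 _).2; rewrite -yE.
have redk t : k t -> forall n, t ^+ n = 0 -> t = 0.
  move=> [x Rx ->] n; rewrite -rmorphXn => /pC Cxn; apply/pC.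
  exact: redR Rx Cxn.
have igk := dcc_reduced_idempotent_generated hk dcck redk.
have sepk : separable k.
  apply: formally_unramified_separable.
    exists [seq p x | x <- g] => a T [hT kT] Tg; have [x ->] := psurj a.
    apply: (gP x (fun x => T (p x))) => [|y yg]; last exact/Tg/map_f.
    case: hT => T1 TB TM; split; last by move=> r Rr; apply: kT; exists r.
    by split=> [|x1 y1 h h'|x1 y1 h h']; rewrite ?(rmorph1, rmorphB, rmorphM) //;
       [exact: TB | exact: TM].
  move=> E f h fh I J hI hJ fhI IJ a; have [x ->] := psurj a.
  apply: (kahler_zero_formally_unramified kz (f := f \o p) (g := h \o p) _ hI hJ) => //=.
  by move=> r Rr; apply: fh; exists r.
split.
  have [w wP] := separable_finite hk igk sepk.
  have [s sP] := choice psurj.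
  (* Lifts of the generators reach [x] only modulo [C]. As [C] lies in [R], the error [x - y] can
     serve as the coefficient of the additional generator [1]. *)
  exists (1 :: [seq s y | y <- w]) => x.
  have [c kc xE] := wP (p x).
  have [d dP] := choice (fun i => ltac:(by case: (kc i) => r Rr cE; exists r; exact: conj Rr cE) :
     exists r, R r /\ c i = p r).
  pose y := \sum_(i < size w) d i * s w`_i.
  have Cxy : C (x - y).
    apply: pE; rewrite xE rmorph_sum; apply: eq_bigr => i _.
    by rewrite rmorphM -sP (proj2 (dP i)).
  exists (x - y :: [seq d i | i <- iota 0 (size w)]); split.
  - by rewrite /= !size_map size_iota.
  - case=> [|i] /=; first exact: CR.
    (* The condition on coefficients ranges over all indices; past the end the default value is [0],
       an element of [R]. *)
    have [iw|iw] := ltnP i (size w); last first.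
      by rewrite nth_default ?size_map ?size_iota //; exact: subring0.
    by rewrite (nth_map 0%N) ?size_iota // nth_iota //; case: (dP i).
  - rewrite /= big_ord_recl /= mulr1 size_map -[LHS](subrK y); congr (_ + _).
    apply: eq_bigr => i _; rewrite !add0n (nth_map 0%N) ?size_iota // nth_iota // add0n.
    by rewrite (nth_map 0).
have [L LP] := separable_FIP hk dcck igk sepk.
(* Each subalgebra [T] contains [R], hence [C], and is therefore the preimage of its image in
   [A]. *)
exists [seq (fun x => T (p x)) | T <- L] => T [hT RT].
have [|T' T'L T'P] := LP (image_of p T).
  by split; [exact: subring_image | move=> _ [r /RT Tr ->]; exists r].
exists (fun x => T' (p x)).
  by elim: L T'L {LP} => //= U L IH [->|/IH]; [left | right].
move=> x; split=> [Tx|/T'P[y Ty /pE /CR /RT Txy]]; first by apply/T'P; exists x.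
by rewrite -[x](subrK y); exact: subringD.
Qed.
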